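(* Let $L\in\{\operatorname{Im}(\mathbb{I}),\mathbb{I}_0\}$ and let $\Lambda$ be an icosahedral model set with underlying $\mathbb{Z}$-module $L$. Further, let $U\subset\mathbb{S}^2$ be any set of $k+1$ pairwise non-parallel $L$-directions, where $k\in\mathbb{N}_0=\{0,1,2,\dots\}$. Then $\mathcal{F}_{\leq k}(\Lambda)$ is determined by the $X$-rays in the directions of $U$. Moreover, for all $F\in\mathcal{F}_{\leq k}(\Lambda)$, one has $G^F_U=F$.
   Context: Notation: $\tau=(1+\sqrt5)/2$; $.'$ is the non-trivial Galois automorphism of $\mathbb{Q}(\tau)$, so $\tau'=1-\tau$; $\mathbb{Z}[\tau]=\mathbb{Z}\oplus\mathbb{Z}\tau$. Modules: The icosian ring $\mathbb{I}$ is the additive subgroup of the Hamiltonian quaternions $\mathbb{H}\cong\mathbb{R}^4$ (basis $1,i,j,k$) generated by all even permutations of the coordinates of $(\pm1,0,0,0)$, $\tfrac12(\pm1,\pm1,\pm1,\pm1)$, $\tfrac12(0,\pm1,\pm\tau',\tau)$. For $\alpha=a+bi+cj+dk$ put $\operatorname{Im}(\alpha)=(b,c,d)^t\in\mathbb{R}^3$. $\operatorname{Im}(\mathbb{I})$ is the set of imaginary parts of all elements of $\mathbb{I}$, and $\mathbb{I}_0$ is the set of imaginary parts of those elements of $\mathbb{I}$ with real part $0$. Explicitly, $\operatorname{Im}(\mathbb{I})=\tfrac12\{(\beta,\gamma,\delta)^t\in\mathbb{Z}[\tau]^3\mid\tau^2\beta+\tau\gamma+\delta\equiv0\ (\mathrm{mod}\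 2)\}$ and $\mathbb{I}_0=\tfrac12\{(\beta,\gamma,\delta)^t\in\mathbb{Z}[\tau]^3\mid\beta\equiv\tau\gamma\equiv\tau^2\delta\ (\mathrm{mod}\ 2)\}$. The star map $.^\star$ applies $.'$ to each coordinate of an element of $\mathbb{Q}(\tau)^3\supset L$. Icosahedral model sets: A window is a set $W\subset\mathbb{R}^3$ with $\varnothing\neq\operatorname{int}(W)\subset W\subset\operatorname{cl}(\operatorname{int}(W))$ and $\operatorname{cl}(\operatorname{int}(W))$ compact. Icosahedral model sets with underlying $\mathbb{Z}$-module $L$ are the sets $\Lambda_{\rm ico}(t,W)=t+\{\alpha\in L\mid\alpha^\star\in W\}$ with $W$ a window and $t\in\mathbb{R}^3$. Directions and $X$-rays: A direction is an element of the unit sphere $\mathbb{S}^2\subset\mathbb{R}^3$; an $L$-direction is a direction parallel to a non-zero element of $L-L=L$. For a finite set $F\subset\mathbb{R}^3$ and a direction $u$, the $X$-ray $X_uF$ is the function assigning to each line $\ell$ in $\mathbb{R}^3$ parallel to $u$ the number $\operatorname{card}(F\cap\ell)$; $\operatorname{supp}(X_uF)$ is the set of lines parallel to $u$ meeting $F$. The grid of $F$ is $G^F_U=\bigcap_{u\in U}\big(\bigcup_{\ell\in\operatorname{supp}(X_uF)}\ell\big)$. A set $\mathcal{E}$ of finite subsets of $\mathbb{R}^3$ is determined by the $X$-rays in the directions of a finite set $U\subset\mathbb{S}^2$ if for all $F,F'\in\mathcal{E}$, $X_uF=X_uF'$ for all $u\in U$ implies $F=F'$. $\mathcal{F}_{\leq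 k}(\Lambda)$ is the set of finite subsets of $\Lambda$ of cardinality at most $k$. *)

(* Defs.v *)
From mathcomp Require Import all_boot all_order all_fingroup all_algebra.
From mathcomp Require Import ring lra.
From mathcomp Require Import finmap.
From mathcomp Require Import all_classical all_reals all_analysis.

Set Implicit Arguments.
Unset Strict Implicit.
Unset Printing Implicit Defensive.

Import Order.TTheory GRing.Theory Num.Theory.
Import numFieldNormedType.Exports.

Local Open Scope classical_set_scope.
Local Open Scope ring_scope.

Section GoldenField.
Variable R : realType.

Definition tau : R := (1 + Num.sqrt 5) / 2.
Definition tau' : R := 1 - tau.

(* The Galois automorphism p + q tau |-> p + q tau' of Q(tau), extended by 0
   outside Q(tau); [galE] below shows that it is well defined on Q(tau). *)
Definition gal (x : R) : R :=
  xget 0 [set y | exists p q : rat,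
    x = ratr p + ratr q * tau /\ y = ratr p + ratr q * tau'].

Lemma sqr_rat_neq5 (r : rat) : r ^+ 2 != 5.
Proof.
apply/negP => /eqP r2.
have d0 : (denq r)%:~R != 0 :> rat by rewrite intr_eq0 denq_neq0.
have : (numq r * numq r)%:~R = (5 * (denq r * denq r))%:~R :> rat.
  rewrite !intrM -[X in _ = X * _]/(5 : rat) -r2 -{3}[r]divq_num_den.
  by field.
move=> /(@intr_inj rat)/(congr1 absz).
rewrite !abszM => /(congr1 (logn 5)).
have dn : (0 < `|denq r|)%N by rewrite absz_gt0 denq_neq0.
have nn : (0 < `|numq r|)%N.
  rewrite absz_gt0 numq_eq0; apply/eqP => r0.
  by move: r2; rewrite r0 expr0n.
rewrite !lognM ?muln_gt0 ?dn ?nn// (_ : logn 5 `|5%Z| = 1%N)//.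
by move=> /(congr1 odd); rewrite !oddD !addbb.
Qed.

Lemma tau_irrational (r : rat) : tau != ratr r.
Proof.
apply/negP => /eqP taur.
have s5 : Num.sqrt 5 = ratr (2 * r - 1) :> R.
  rewrite rmorphB rmorphM /= rmorph1 rmorph_nat -taur /tau; by field.
have /eqP := sqr_rat_neq5 (2 * r - 1); case.
apply: (fmorph_inj (@ratr R)).
by rewrite rmorphXn/= -s5 sqr_sqrtr// rmorph_nat.
Qed.

Lemma galE (p q : rat) : gal (ratr p + ratr q * tau) = ratr p + ratr q * tau'.
Proof.
apply: xget_unique; first by exists p, q.
move=> _ [p' [q' [e ->]]].
have [qq|qq] := eqVneq q q'.
  by move: e; rewrite qq => /addIr ->.
have q0 : ratr (q - q') != 0 :> R by rewrite fmorph_eq0 subr_eq0.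
have /eqP := tau_irrational ((p' - p) / (q - q')); case.
rewrite fmorph_div; apply: (mulIf q0); rewrite divfK// !rmorphB/=.
lra.
Qed.

End GoldenField.

Section Icosians.
Variable R : realType.

(* A quaternion a + bi + cj + dk is the column vector (a, b, c, d)^t. *)
Definition quat (a b c d : R) : 'cV[R]_4 := \col_(i < 4) [:: a; b; c; d]`_i.

Definition re (q : 'cV[R]_4) : R := q ord0 0.
Definition im (q : 'cV[R]_4) : 'cV[R]_3 := \col_(i < 3) q (lift ord0 i) 0.

Definition icosian_base : set 'cV[R]_4 :=
  [set quat ((-1) ^+ b) 0 0 0 | b in [set: bool]] `|`
  [set v | exists b0 b1 b2 b3 : bool, v = 2^-1 *:
     quat ((-1) ^+ b0) ((-1) ^+ b1) ((-1) ^+ b2) ((-1) ^+ b3)] `|`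
  [set v | exists b1 b2 : bool, v = 2^-1 *:
     quat 0 ((-1) ^+ b1) ((-1) ^+ b2 * tau' R) (tau R)].

Definition icosian_generators : set 'cV[R]_4 :=
  [set v | exists2 s : 'S_4, ~~ odd_perm s
         & exists2 w, icosian_base w & v = row_perm s w].

Definition icosian : set 'cV[R]_4 :=
  smallest (fun M => zmod_closed (mem M)) icosian_generators.

Definition Im_icosian : set 'cV[R]_3 := [set im q | q in icosian].

Definition icosian0 : set 'cV[R]_3 :=
  [set im q | q in [set q | icosian q /\ re q = 0]].

End Icosians.

Arguments Im_icosian : clear implicits.
Arguments icosian0 : clear implicits.

Section ModelSets.
Variable R : realType.

Definition star (v : 'cV[R]_3) : 'cV[R]_3 := map_mx (@gal R) v.

Definition window (W : set 'cV[R]_3) : Prop :=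
  [/\ interior W !=set0, interior W `<=` W, W `<=` closure (interior W)
    & compact (closure (interior W))].

Definition Lambda_ico (L : set 'cV[R]_3) (t : 'cV[R]_3) (W : set 'cV[R]_3) :
  set 'cV[R]_3 := [set t + a | a in [set a | L a /\ W (star a)]].

Definition icosahedral_model_set (L Lambda : set 'cV[R]_3) : Prop :=
  exists t W, window W /\ Lambda = Lambda_ico L t W.

End ModelSets.

Section Xrays.
Variable R : realType.
Local Notation V := 'cV[R]_3.

(* [fset_set A] is empty when A is infinite, so this is 0 on infinite sets. *)
Definition card_set (T : choiceType) (A : set T) : nat := #|` fset_set A|.

(* The library norm on matrices is the sup norm, hence the explicit sum. *)
Definition direction : set V := [set u | \sum_i u i 0 ^+ 2 = 1].

Definition parallel (u v : V) : Prop := exists2 c : R, c != 0 & v = c *: u.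

Definition L_direction (L : set V) : set V :=
  [set u | direction u /\ exists a, [/\ L a, a != 0 & parallel u a]].

Definition lines (u : V) : set (set V) :=
  [set l | exists x, l = range (fun t : R => x + t *: u)].

Definition xray (u : V) (F : set V) : lines u -> nat :=
  fun l => card_set (F `&` set_val l).

Definition xray_supp (u : V) (F : set V) : set (set V) :=
  [set l | lines u l /\ F `&` l !=set0].

Definition grid (U F : set V) : set V :=
  \bigcap_(u in U) \bigcup_(l in xray_supp u F) l.

Definition determined_by_xrays (U : set V) (E : set (set V)) : Prop :=
  forall F F', E F -> E F' ->
    (forall u, U u -> xray (u := u) F = xray (u := u) F') -> F = F'.

Definition finite_subsets_le (k : nat) (Lambda : set V) : set (set V) :=
  [set F | [/\ finite_set F, F `<=` Lambda & (card_set F <= k)%N]].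

End Xrays.

(* Main.v *)
Require Import Defs.
From mathcomp Require Import all_boot all_order all_fingroup all_algebra.
From mathcomp Require Import finmap.
From mathcomp Require Import all_classical all_reals all_analysis.

Import Order.TTheory GRing.Theory Num.Theory.
Import numFieldNormedType.Exports.

Local Open Scope classical_set_scope.
Local Open Scope ring_scope.

(** The grid of [F] recovers [F] by the pigeonhole principle. A point [x] of
    the grid sees, along every direction [u] in [U], some point of [F] on its
    line parallel to [u]. Since [F] has fewer points than [U] has directions,
    two distinct directions [u], [v] lead to the same point [y] of [F]. Then
    [x - y] is a multiple of both [u] and [v], which are not parallel, so
    [x = y] lies in [F]; this is [grid_id].

    The grid depends on the X-rays only through their supports, and the support
    of the X-ray of a finite set is where that X-ray is positive. Two finite
    sets with the same X-rays thus have the same grid ([eq_xray_grid]), and if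
    both are small enough to be equal to their grids, they coincide. *)

Lemma card_set_gt0 (T : choiceType) (A : set T) :
  finite_set A -> (0 < card_set A)%N <-> A !=set0.
Proof.
move=> fA; rewrite /card_set cardfs_gt0; split.
  by move=> /fset0Pn[x]; rewrite in_fset_set// inE => Ax; exists x.
by move=> [x Ax]; apply/fset0Pn; exists x; rewrite in_fset_set// inE.
Qed.

Lemma card_set_inj_le (T T' : choiceType) (A : set T) (B : set T') (f : T -> T') :
    finite_set A -> finite_set B -> (forall x, A x -> B (f x)) ->
    {in A &, injective f} ->
  (card_set A <= card_set B)%N.
Proof.
move=> fA fB fAB finj; rewrite /card_set.
have finj' : {in fset_set A &, injective f}.
  by move=> x y; rewrite !in_fset_set//; apply: finj.
rewrite -(card_in_imfset imfset_key finj').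
apply/fsubset_leq_card/fsubsetP => _ /imfsetP[x /= xA ->].
by move: xA; rewrite !in_fset_set// !inE; apply: fAB.
Qed.

Section Grid.
Variable R : realType.
Implicit Types (U F : set 'cV[R]_3) (u v x y : 'cV[R]_3).

Lemma sub_grid U F : F `<=` grid U F.
Proof.
move=> x Fx u Uu; exists (range (fun t : R => x + t *: u)).
  by split; [exists x | exists x; split=> //; exists 0; rewrite // scale0r addr0].
by exists 0; rewrite // scale0r addr0.
Qed.

Lemma grid_exists U F x u :
  grid U F x -> U u -> exists2 y, F y & exists c : R, x - y = c *: u.
Proof.
move=> Gx Uu; have [l [[z ->] [y [Fy [s _ ys]]]] [t _ xt]] := Gx u Uu.
exists y => //; exists (t - s).
by rewrite -xt -ys scalerBl opprD addrACA subrr add0r.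
Qed.

Lemma nparallel_scale_eq0 u v x (a b : R) :
  ~ parallel u v -> x = a *: u -> x = b *: v -> x = 0.
Proof.
move=> npar xu xv; apply: contrapT => /eqP x0; apply: npar.
have a0 : a != 0 by apply: contra_neq x0 => a0; rewrite xu a0 scale0r.
have b0 : b != 0 by apply: contra_neq x0 => b0; rewrite xv b0 scale0r.
exists (b^-1 * a); first by rewrite mulf_neq0 ?invr_eq0.
by rewrite -scalerA -xu xv scalerA mulVf// scale1r.
Qed.

(** The choice, for each direction, of a point of [F] on the line through [x]
    cannot be injective on [U]; a collision forces [x] to be in [F]. *)
Lemma grid_id U F :
    finite_set U -> finite_set F -> (card_set F < card_set U)%N ->
    (forall u v, U u -> U v -> u <> v -> ~ parallel u v) ->
  grid U F = F.
Proof.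
move=> fU fF FU npar; apply/seteqP; split; last exact: sub_grid.
move=> x Gx; apply: contrapT => nFx.
have /choice[f fP] (u : 'cV[R]_3) :
    exists y, U u -> F y /\ exists c : R, x - y = c *: u.
  have [Uu|nUu] := pselect (U u); last by exists 0.
  by have [y Fy yc] := grid_exists _ _ _ _ Gx Uu; exists y.
suff : (card_set U <= card_set F)%N by rewrite leqNgt FU.
apply: (@card_set_inj_le _ _ _ _ f) => // [u /fP[]//|u v].
rewrite !inE => Uu Uv fuv; apply: contrapT => uv.
have [[Fu [a xa]] [_ [b xb]]] := (fP u Uu, fP v Uv).
rewrite -fuv in xb.
have /eqP := nparallel_scale_eq0 _ _ _ _ _ (npar _ _ Uu Uv uv) xa xb.
by rewrite subr_eq0 => /eqP xf; apply: nFx; rewrite xf.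
Qed.

(** Finiteness matters: on an infinite intersection with a line the X-ray takes
    the default value [0], although the line is in the support. *)
Lemma mem_xray_supp F u (l : lines u) :
  finite_set F -> xray_supp u F (set_val l) <-> (0 < xray F l)%N.
Proof.
move=> fF; rewrite /xray card_set_gt0; last exact: finite_setIl.
by split=> [[]//|Fl]; split=> //; apply: set_valP.
Qed.

Lemma eq_xray_supp F F' u : finite_set F -> finite_set F' ->
  xray (u := u) F = xray (u := u) F' -> xray_supp u F = xray_supp u F'.
Proof.
move=> fF fF' FF'; apply/seteqP; split=> l sl; have [ul _] := sl.
  have := mem_xray_supp F u (SigSub (mem_set ul)) fF.
  by rewrite FF' -mem_xray_supp// => -[+ _]; apply.
have := mem_xray_supp F' u (SigSub (mem_set ul)) fF'.
by rewrite -FF' -mem_xray_supp// => -[+ _]; apply.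
Qed.

Lemma eq_xray_grid U F F' : finite_set F -> finite_set F' ->
    (forall u, U u -> xray (u := u) F = xray (u := u) F') ->
  grid U F = grid U F'.
Proof.
by move=> fF fF' FF'; apply: eq_bigcapr => u /FF' /eq_xray_supp ->.
Qed.

End Grid.

Theorem proposition5p3 (R : realType) (L : set 'cV[R]_3)
    (hL : L = Im_icosian R \/ L = icosian0 R)
    (Lambda : set 'cV[R]_3) (hLambda : icosahedral_model_set L Lambda)
    (k : nat) (U : set 'cV[R]_3)
    (hUfin : finite_set U) (hUcard : card_set U = k.+1)
    (hUdir : U `<=` L_direction L)
    (hUpar : forall u v, U u -> U v -> u <> v -> ~ parallel u v) :
  determined_by_xrays U (finite_subsets_le k Lambda) /\
  (forall F, finite_subsets_le k Lambda F -> grid U F = F).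
Proof.
have gridF F : finite_subsets_le k Lambda F -> grid U F = F.
  by move=> [fF _ Fk]; apply: grid_id => //; rewrite hUcard ltnS.
split=> // F F' kF kF' FF'.
rewrite -(gridF F)// -(gridF F')//.
by case: kF kF' => [fF _ _] [fF' _ _]; apply: eq_xray_grid.
Qed.
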